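(* Let $\lambda_{N,T}>0$ and $\mu_{N,T}>0$ be arbitrary and suppose that $\kappa^2>0$. Then on the event $\mathcal{A}_{N,T}\cap\mathcal{B}_{N,T}$ one has $$\|\hat\beta-\beta^*\|\le \frac{8\lambda_{N,T}\sqrt{s_1}}{\kappa^2NT}+\frac{4\mu_{N,T}\sqrt{s_2}}{\kappa^2\sqrt{N}\,T}$$ and $$\|\hat c-c^*\|\le \frac{8\mu_{N,T}\sqrt{s_2}}{\kappa^2T}+\frac{4\lambda_{N,T}\sqrt{s_1}}{\kappa^2\sqrt{N}\,T}.$$
   Context: Model: for $i=1,\dots,N$, $t=1,\dots,T$, $y_{i,t}=x_{i,t}'\beta^*+c_i^*+\epsilon_{i,t}$ with covariates $x_{i,t}\in\mathbb{R}^p$, unknown deterministic vectors $\beta^*\in\mathbb{R}^p$, $c^*=(c_1^*,\dots,c_N^* )'\in\mathbb{R}^N$ and errors $\epsilon_{i,t}$. Put $X_i=(x_{i,1},\dots,x_{i,T})'$, $X=(X_1',\dots,X_N')'$, $y_i=(y_{i,1},\dots,y_{i,T})'$, $\epsilon_i=(\epsilon_{i,1},\dots,\epsilon_{i,T})'$, $y=(y_1',\dots,y_N')'$, $\epsilon=(\epsilon_1',\dots,\epsilon_N')'$, $D=I_N\otimes\iota$ with $\iota$ the $T\times1$ vector of ones, $Z=(X,D)$ and $\gamma^*=({\beta^*}',{c^*}')'$, so that $y=Z\gamma^*+\epsilon$. Let $J_1=\{j:\beta_j^*\ne0\}$, $J_2=\{i:c_i^*\neq0\}$, $s_1=|J_1|$,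 $s_2=|J_2|$. $\|\cdot\|$, $\|\cdot\|_{\ell_1}$, $\|\cdot\|_{\ell_\infty}$ are the $\ell_2$-, $\ell_1$- and $\ell_\infty$-norms; $v_A$ is the subvector of $v$ indexed by $A$. Panel Lasso: $\hat\gamma=(\hat\beta',\hat c')'$ is a minimizer over $(\beta,c)\in\mathbb{R}^p\times\mathbb{R}^N$, $\gamma=(\beta',c')'$, of $\|y-Z\gamma\|^2+2\lambda_{N,T}\|\beta\|_{\ell_1}+2\mu_{N,T}\|c\|_{\ell_1}$. Restricted eigenvalues: let $S=\mathrm{diag}(\sqrt{NT}\,I_p,\sqrt T\,I_N)$, $\Psi_{N,T}=S^{-1}Z'ZS^{-1}$ and $\Gamma=\mathrm{diag}(E(X'X/(NT)),I_N)$ (block diagonal). For a positive semi-definite $(p+N)\times(p+N)$ matrix $M$ let $\kappa_M^2(r_1,r_2)$ be the minimum of $\delta'M\delta/\|\delta\|^2$ over all $\delta=({\delta^1}',{\delta^2}')'\in\mathbb{R}^{p+N}\setminus\{0\}$ ($\delta^1\in\mathbb{R}^p$, $\delta^2\in\mathbb{R}^N$) and all $R_1\subseteq\{1,\dots,p\}$, $R_2\subseteq\{1,\dots,N\}$ with $|R_1|\le r_1$, $|R_2|\le r_2$ and $$\tfrac{\lambda_{N,T}}{\sqrt{NT}}\|\delta^1_{R_1^c}\|_{\ell_1}+\tfrac{\mu_{N,T}}{\sqrt T}\|\delta^2_{R_2^c}\|_{\ell_1}\le 3\tfrac{\lambda_{N,T}}{\sqrt{NT}}\|\delta^1_{R_1}\|_{\ell_1}+3\tfrac{\mu_{N,T}}{\sqrt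 T}\|\delta^2_{R_2}\|_{\ell_1}.$$ Write $\kappa^2=\kappa^2_\Gamma(s_1,s_2)$ and $\kappa^2_{\Psi_{N,T}}=\kappa^2_{\Psi_{N,T}}(s_1,s_2)$. Events: $\mathcal{A}_{N,T}=\{\|X'\epsilon\|_{\ell_\infty}\le\lambda_{N,T}/2,\ \|D'\epsilon\|_{\ell_\infty}\le\mu_{N,T}/2\}$ and $\mathcal{B}_{N,T}=\{\kappa^2_{\Psi_{N,T}}\ge\kappa^2/2\}$. The result is deterministic (no distributional assumptions). *)

(* Defs.v *)
From HB Require Import structures.
From mathcomp Require Import all_boot all_order all_algebra.
From mathcomp Require Import all_classical all_reals all_analysis.

Set Implicit Arguments.
Unset Strict Implicit.
Unset Printing Implicit Defensive.

Import Order.TTheory GRing.Theory Num.Theory.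
Import numFieldNormedType.Exports.

Local Open Scope classical_set_scope.
Local Open Scope ring_scope.

Section Norms.
Variables (R : realType) (n : nat).
Implicit Types (v : 'cV[R]_n) (A : {set 'I_n}).

(* The library norm [`|v|] of a matrix is the sup norm, so the l2 and l1 norms
   are defined here and [`|v|] is used for the l-infinity norm. *)
Definition l2norm v : R := Num.sqrt (\sum_(i < n) v i 0 ^+ 2).

Definition l1norm v : R := \sum_(i < n) `|v i 0|.

(* l1 norm of the subvector v_A *)
Definition l1norm_on A v : R := \sum_(i in A) `|v i 0|.

Definition supp v : {set 'I_n} := [set i | v i 0 != 0]%SET.

End Norms.

Section RestrictedEigenvalue.
Variables (R : realType) (N T p : nat) (lambda mu : R).

Definition re_cone (R1 : {set 'I_p}) (R2 : {set 'I_N}) (delta : 'cV[R]_(p + N)) :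
    bool :=
  let delta1 := usubmx delta in
  let delta2 := dsubmx delta in
  let a := lambda / Num.sqrt (N * T)%:R in
  let b := mu / Num.sqrt T%:R in
  a * l1norm_on (~: R1)%SET delta1 + b * l1norm_on (~: R2)%SET delta2
    <= 3 * a * l1norm_on R1 delta1 + 3 * b * l1norm_on R2 delta2.

Definition re_admissible (r1 r2 : nat) : set 'cV[R]_(p + N) :=
  [set delta : 'cV[R]_(p + N) | delta != 0 /\
    exists (R1 : {set 'I_p}) (R2 : {set 'I_N}),
      [/\ (#|R1| <= r1)%N, (#|R2| <= r2)%N & re_cone R1 R2 delta]].

(* kappa_M^2(r1, r2).  The quotient and the constraints are invariant under positive
   scaling and the admissible unit vectors form a compact set, so the infimum is a
   minimum as soon as an admissible vector exists.  For positive lambda and mu none exists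
   exactly when both cardinality bounds leave only empty R1, R2; the value is
   then +oo, the minimum over the empty set. *)
Definition kappa2 (M : 'M[R]_(p + N)) (r1 r2 : nat) : \bar R :=
  ereal_inf [set ((delta^T *m M *m delta) 0 0 / l2norm delta ^+ 2)%:E
            | delta in re_admissible r1 r2].

End RestrictedEigenvalue.

Section Panel.
Variables (R : realType) (N T p : nat).

(* (a_1', ..., a_N')' for an N x T panel a, with a_i = (a_{i,1}, ..., a_{i,T})' *)
Definition stack (a : 'I_N -> 'I_T -> R) : 'cV[R]_(\sum_(i < N) T) :=
  \mxcol_(i < N) (\col_(t < T) a i t).

Definition design (x : 'I_N -> 'I_T -> 'I_p -> R) : 'M[R]_(\sum_(i < N) T, p) :=
  \mxcol_(i < N) (\matrix_(t < T, j < p) x i t j).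

(* I_N (x) iota: the i-th block of T rows has ones in column i, zeros elsewhere *)
Definition dummies : 'M[R]_(\sum_(i < N) T, N) :=
  \mxcol_(i < N) (\matrix_(t < T, k < N) (k == i)%:R).

Definition regressors (x : 'I_N -> 'I_T -> 'I_p -> R) :
    'M[R]_(\sum_(i < N) T, p + N) :=
  row_mx (design x) dummies.

Definition lasso_objective (lambda mu : R) (x : 'I_N -> 'I_T -> 'I_p -> R)
    (y : 'I_N -> 'I_T -> R) (beta : 'cV[R]_p) (c : 'cV[R]_N) : R :=
  l2norm (stack y - regressors x *m col_mx beta c) ^+ 2
    + 2 * lambda * l1norm beta + 2 * mu * l1norm c.

Definition panel_lasso (lambda mu : R) (x : 'I_N -> 'I_T -> 'I_p -> R)
    (y : 'I_N -> 'I_T -> R) (betahat : 'cV[R]_p) (chat : 'cV[R]_N) : Prop :=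
  forall beta c, lasso_objective lambda mu x y betahat chat
                 <= lasso_objective lambda mu x y beta c.

Definition scaling : 'M[R]_(p + N) :=
  block_mx (Num.sqrt (N * T)%:R)%:M 0 0 (Num.sqrt T%:R)%:M.

Definition Psi (x : 'I_N -> 'I_T -> 'I_p -> R) : 'M[R]_(p + N) :=
  invmx scaling *m (regressors x)^T *m regressors x *m invmx scaling.

Definition gram (x : 'I_N -> 'I_T -> 'I_p -> R) : 'M[R]_p :=
  (N * T)%:R^-1 *: ((design x)^T *m design x).

End Panel.

Arguments dummies R N T : clear implicits.
Arguments scaling R N T p : clear implicits.

Section RandomPanel.
Variables (R : realType) (d : measure_display) (Omega : measurableType d).
Variables (P : probability Omega R) (N T p : nat).
Variables (x : 'I_N -> 'I_T -> 'I_p -> {RV P >-> R}).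
Variables (eps : 'I_N -> 'I_T -> {RV P >-> R}).

Definition covariates_at (w : Omega) (i : 'I_N) (t : 'I_T) (j : 'I_p) : R :=
  x i t j w.

Definition panel_at (u : 'I_N -> 'I_T -> {RV P >-> R}) (w : Omega)
  (i : 'I_N) (t : 'I_T) : R := u i t w.

(* E(X'X/(NT)) exists as a real matrix *)
Definition gram_integrable : Prop := forall j k : 'I_p,
  P.-integrable setT (fun w => (gram (covariates_at w) j k)%:E).

Definition Gamma : 'M[R]_(p + N) :=
  block_mx
    (\matrix_(j < p, k < p) fine 'E_P[fun w => gram (covariates_at w) j k]) 0
    0 1%:M.

Definition eventA (lambda mu : R) : set Omega :=
  [set w | `|(design (covariates_at w))^T *m stack (panel_at eps w)| <= lambda / 2
        /\ `|(dummies R N T)^T *m stack (panel_at eps w)| <= mu / 2].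

Definition eventB (lambda mu : R) (s1 s2 : nat) : set Omega :=
  [set w | (kappa2 T lambda mu Gamma s1 s2 / 2%:E
            <= kappa2 T lambda mu (Psi (covariates_at w)) s1 s2)%E].

End RandomPanel.

(* Main.v *)
Require Import Defs.
From HB Require Import structures.
From mathcomp Require Import all_boot all_order all_algebra.
From mathcomp Require Import all_classical all_reals all_analysis.
From mathcomp Require Import ring lra.
Import Order.TTheory GRing.Theory Num.Theory.
Import numFieldNormedType.Exports.
Local Open Scope classical_set_scope.
Local Open Scope ring_scope.

(** Write [u] and [v] for the errors in the two blocks of coefficients.
Comparing the objective at the estimator with its value at the truth, and
bounding the noise term by Hoelder on the first event, gives the basic inequality
([lasso_basic_inequality])

  [l2norm (Z (u, v)) ^+ 2 + lambda * l1norm u + mu * l1norm v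
     <= 4 * lambda * l1norm_on J1 u + 4 * mu * l1norm_on J2 v],

[J1] and [J2] being the supports of the true coefficients.  It is used twice.

Dropping the square, it says that the rescaled error [delta = S (u, v)] lies in
the restricted cone ([re_cone_scaling]).  Hence, unless [delta] vanishes, the
second event bounds [kappa ^+ 2 / 2 * l2norm delta ^+ 2] by
[delta^T Psi delta], which is the squared prediction error since the scalings
cancel ([Psi_scaling]).

Dropping the l1 norms on the left instead, and applying Cauchy-Schwarz on the
supports ([l1norm_on_le]), the squared prediction error is at most
[4 * (lambda * sqrt s1 * l2norm u + mu * sqrt s2 * l2norm v)].

Together these form an inequality [A ^+ 2 + B ^+ 2 <= k * (a * A + b * B)]
between [A = l2norm (sqrt (N T) u)] and [B = l2norm (sqrt T v)].  Completing
the square in one variable bounds the other ([le_of_sqrD_le_linear]), which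
explains why each bound has its own penalty with constant 8 and the other one
with constant 4.

If [delta = 0] there is no error and the bounds only assert that their right-hand
sides are nonnegative.  If [delta != 0] it is itself admissible for
the restricted eigenvalue, which is therefore finite; this covers the
convention that the minimum over an empty set is infinite. *)

(** * Norms of column vectors *)

Section Norms.
Context {R : realType} {n : nat}.
Implicit Types (u v w : 'cV[R]_n) (A : {set 'I_n}).

Lemma l2norm_ge0 v : 0 <= l2norm v.
Proof. exact: sqrtr_ge0. Qed.

Lemma sqr_l2norm v : l2norm v ^+ 2 = \sum_i v i 0 ^+ 2.
Proof. by rewrite sqr_sqrtr// sumr_ge0// => i _; exact: sqr_ge0. Qed.

Lemma sqr_l2normE v : l2norm v ^+ 2 = (v^T *m v) 0 0.
Proof. by rewrite sqr_l2norm mxE; apply: eq_bigr => i _; rewrite mxE expr2. Qed.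

Lemma l2norm0 : l2norm (0 : 'cV[R]_n) = 0.
Proof.
by rewrite /l2norm big1 ?sqrtr0// => i _; rewrite mxE expr0n.
Qed.

Lemma l2norm_gt0 v : v != 0 -> 0 < l2norm v.
Proof.
move=> v0; rewrite lt_neqAle l2norm_ge0 andbT eq_sym; apply: contra v0.
rewrite -sqrf_eq0 sqr_l2norm psumr_eq0 => [/allP h|i _]; last exact: sqr_ge0.
apply/eqP/colP => i; apply/eqP; rewrite [X in _ == X]mxE -sqrf_eq0.
exact: (h i (mem_index_enum i)).
Qed.

Lemma l2normZ (a : R) v : 0 <= a -> l2norm (a *: v) = a * l2norm v.
Proof.
move=> a0; rewrite -[in RHS](ger0_norm a0) -sqrtr_sqr /l2norm.
rewrite -sqrtrM ?sqr_ge0// mulr_sumr; congr Num.sqrt.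
by apply: eq_bigr => i _; rewrite mxE exprMn.
Qed.

Lemma l1norm_on_ge0 A v : 0 <= l1norm_on A v.
Proof. exact: sumr_ge0. Qed.

Lemma l1norm_ge0 v : 0 <= l1norm v.
Proof. exact: sumr_ge0. Qed.

Lemma l1norm_split A v : l1norm v = l1norm_on A v + l1norm_on (~: A)%SET v.
Proof.
rewrite /l1norm (bigID (mem A))/=; congr (_ + _).
by apply: eq_bigl => i; rewrite inE.
Qed.

Lemma l1norm_onZ A (a : R) v :
  0 <= a -> l1norm_on A (a *: v) = a * l1norm_on A v.
Proof.
move=> a0; rewrite /l1norm_on mulr_sumr; apply: eq_bigr => i _.
by rewrite mxE normrM ger0_norm.
Qed.

(** Cauchy-Schwarz against the indicator of [A].  Expanding the square into a
double sum, each cross term is bounded by the arithmetic-geometric mean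
inequality. *)
Lemma l1norm_on_le A v : l1norm_on A v <= Num.sqrt #|A|%:R * l2norm v.
Proof.
rewrite -[leLHS]ger0_norm ?l1norm_on_ge0// -sqrtr_sqr /l2norm -sqrtrM ?ler0n//.
apply: ler_wsqrtr.
have -> : l1norm_on A v ^+ 2
    = \sum_(i in A) \sum_(j in A) `|v i 0| * `|v j 0|.
  by rewrite expr2 mulr_suml; under eq_bigr do rewrite mulr_sumr.
apply: (@le_trans _ _ (#|A|%:R * \sum_(i in A) v i 0 ^+ 2)); last first.
  rewrite ler_wpM2l// big_mkcond/=; apply: ler_sum => i _.
  by case: ifP => // _; exact: sqr_ge0.
apply: (@le_trans _ _ (\sum_(i in A) \sum_(j in A)
    (v i 0 ^+ 2 / 2 + v j 0 ^+ 2 / 2))).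
  apply: ler_sum => i _; apply: ler_sum => j _.
  rewrite -[v i 0 ^+ 2]real_normK ?num_real//.
  rewrite -[v j 0 ^+ 2]real_normK ?num_real//.
  have := sqr_ge0 (`|v i 0| - `|v j 0|); nra.
rewrite le_eqVlt; apply/orP; left; apply/eqP.
under eq_bigr do rewrite big_split/=.
rewrite big_split/= [X in _ + X]exchange_big/= -mulr2n.
under eq_bigr do rewrite sumr_const.
rewrite -sumrMnl mulr_sumr; apply: eq_bigr => i _.
by rewrite mulrnAC -[_ / 2 *+ 2]mulr_natr divfK ?pnatr_eq0// mulr_natl.
Qed.

(** Hoelder's inequality; [`|w|] is the sup norm. *)
Lemma dot_le_sup_l1 w u : (w^T *m u) 0 0 <= `|w| * l1norm u.
Proof.
rewrite mxE /l1norm mulr_sumr; apply: ler_sum => i _.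
rewrite mxE; apply: (le_trans (ler_norm _)); rewrite normrM ler_wpM2r//.
by rewrite [leRHS]/Num.Def.normr/= mx_normrE; apply/bigmax_geP; right; exists (i, 0).
Qed.

(** Off the support of [b] the first two terms contribute [- `|u i 0|], which
cancels the third; on the support the triangle inequality bounds the whole by
[2 * `|u i 0|]. *)
Lemma l1norm_decomposable (b u : 'cV[R]_n) :
  l1norm b - l1norm (b + u) + l1norm u <= 2 * l1norm_on (supp b) u.
Proof.
rewrite /l1norm /l1norm_on -sumrB -big_split/= mulr_sumr [leRHS]big_mkcond/=.
apply: ler_sum => i _; rewrite inE mxE; case: ifPn => [_|/negPn/eqP ->].
  by rewrite mulr_natl mulr2n lerD2r lerBlDr -lerBlDl lerB_normD.
by rewrite normr0 !add0r addNr.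
Qed.

End Norms.

Lemma sqr_l2norm_col_mx {R : realType} {p q : nat}
    (u : 'cV[R]_p) (v : 'cV[R]_q) :
  l2norm (col_mx u v) ^+ 2 = l2norm u ^+ 2 + l2norm v ^+ 2.
Proof.
rewrite !sqr_l2norm big_split_ord/=; congr (_ + _); apply: eq_bigr => i _.
  by rewrite col_mxEu.
by rewrite col_mxEd.
Qed.

Lemma sqr_l2normB {R : realType} {n : nat} (e z : 'cV[R]_n) :
  l2norm (e - z) ^+ 2 = l2norm e ^+ 2 - 2 * (e^T *m z) 0 0 + l2norm z ^+ 2.
Proof.
rewrite !sqr_l2norm !mxE mulr_sumr -sumrB -big_split/=; apply: eq_bigr => i _.
by rewrite !mxE; ring.
Qed.

(** * The basic inequality of the Lasso with two penalties *)

Section BasicInequality.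
Context {R : realType} {n p q : nat}.
Variables (X : 'M[R]_(n, p)) (D : 'M[R]_(n, q)) (e : 'cV[R]_n).
Variables (lambda mu : R) (b bh : 'cV[R]_p) (c ch : 'cV[R]_q).

Let fit (beta : 'cV[R]_p) (gamma : 'cV[R]_q) : 'cV[R]_n :=
  row_mx X D *m col_mx beta gamma.

(** Expanding the square, optimality of [(bh, ch)] bounds the prediction error by
twice the noise term plus the decrease in the penalties.  By Hoelder the former
is at most [lambda * l1norm u + mu * l1norm v], where [u = bh - b] and
[v = ch - c].  Adding this quantity once more to both sides makes the right-hand
side [2 * lambda * (l1norm b - l1norm bh + l1norm u)] plus its analogue for
[mu], to which decomposability of the l1 norm applies. *)
Lemma lasso_basic_inequality :
  0 < lambda -> 0 < mu ->
  `|X^T *m e| <= lambda / 2 -> `|D^T *m e| <= mu / 2 ->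
  l2norm (fit b c + e - fit bh ch) ^+ 2
      + 2 * lambda * l1norm bh + 2 * mu * l1norm ch
    <= l2norm (fit b c + e - fit b c) ^+ 2
      + 2 * lambda * l1norm b + 2 * mu * l1norm c ->
  l2norm (fit (bh - b) (ch - c)) ^+ 2
      + lambda * l1norm (bh - b) + mu * l1norm (ch - c)
    <= 4 * lambda * l1norm_on (supp b) (bh - b)
      + 4 * mu * l1norm_on (supp c) (ch - c).
Proof.
move=> lambda0 mu0 hX hD.
set u := bh - b; set v := ch - c.
have -> : fit b c + e - fit b c = e by rewrite addrC addKr.
have -> : fit b c + e - fit bh ch = e - fit u v.
  by rewrite /fit !mul_row_col /u /v !mulmxBr; apply/matrixP => i j;
     rewrite !mxE; ring.
rewrite sqr_l2normB => hopt.
have hnoise : 2 * (e^T *m fit u v) 0 0 <= lambda * l1norm u + mu * l1norm v.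
  have -> : (e^T *m fit u v) 0 0 = ((X^T *m e)^T *m u) 0 0
                                 + ((D^T *m e)^T *m v) 0 0.
    by rewrite /fit mul_row_col mulmxDr !trmx_mul !trmxK !mulmxA mxE.
  have h1 : ((X^T *m e)^T *m u) 0 0 <= lambda / 2 * l1norm u.
    by apply: (le_trans (dot_le_sup_l1 _ _)); rewrite ler_wpM2r// l1norm_ge0.
  have h2 : ((D^T *m e)^T *m v) 0 0 <= mu / 2 * l1norm v.
    by apply: (le_trans (dot_le_sup_l1 _ _)); rewrite ler_wpM2r// l1norm_ge0.
  lra.
have := l1norm_decomposable b u; have := l1norm_decomposable c v.
have -> : b + u = bh by rewrite /u addrC subrK.
have -> : c + v = ch by rewrite /v addrC subrK.
move=> /(ler_wpM2l (ltW mu0)) hc /(ler_wpM2l (ltW lambda0)) hb.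
lra.
Qed.

End BasicInequality.

(** * From the restricted eigenvalue to the error bounds *)

(** Completing the square in [B] leaves [A * (A - k * a) <= (k * b / 2) ^+ 2],
which fails as soon as both factors exceed [k * b / 2]. *)
Lemma le_of_sqrD_le_linear {R : realFieldType} (k a b A B : R) :
  0 <= k -> 0 <= a -> 0 <= b ->
  A ^+ 2 + B ^+ 2 <= k * (a * A + b * B) -> A <= k * a + k * b / 2.
Proof.
move=> k0 a0 b0 h; rewrite leNgt; apply/negP => hA.
have ka : 0 <= k * a by exact: mulr_ge0.
have kb : 0 <= k * b by exact: mulr_ge0.
have hB := sqr_ge0 (B - k * b / 2).
have hm : k * b / 2 * (k * b / 2) < A * (A - k * a) by apply: ltr_pM; lra.
nra.
Qed.

(** [nu] and [tau] stand for the square roots of the panel dimensions; the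
substitution [A = nu * tau * U], [B = tau * V] reduces this to the previous
lemma. *)
Lemma rescaled_error_bounds {R : realFieldType} (nu tau k L M U V : R) :
  0 < nu -> 0 < tau -> 0 < k -> 0 <= L -> 0 <= M ->
  k / 2 * ((nu * tau * U) ^+ 2 + (tau * V) ^+ 2) <= 4 * (L * U + M * V) ->
  U <= 8 * L / (k * (nu ^+ 2 * tau ^+ 2)) + 4 * M / (k * (nu * tau ^+ 2)) /\
  V <= 8 * M / (k * tau ^+ 2) + 4 * L / (k * (nu * tau ^+ 2)).
Proof.
move=> nu0 tau0 k0 L0 M0 h.
have nz : [/\ nu != 0, tau != 0 & k != 0] by rewrite !gt_eqF.
have [nuz tauz kz] := nz.
have nt0 : 0 < nu * tau by exact: mulr_gt0.
have h' : (nu * tau * U) ^+ 2 + (tau * V) ^+ 2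
    <= 8 / k * (L / (nu * tau) * (nu * tau * U) + M / tau * (tau * V)).
  have -> : 8 / k * (L / (nu * tau) * (nu * tau * U) + M / tau * (tau * V))
      = (k / 2)^-1 * (4 * (L * U + M * V)).
    by field; rewrite nuz tauz kz.
  by rewrite ler_pdivlMl ?divr_gt0.
have k8 : 0 <= 8 / k by rewrite divr_ge0// ltW.
have Lnt : 0 <= L / (nu * tau) by rewrite divr_ge0// ltW.
have Mt : 0 <= M / tau by rewrite divr_ge0// ltW.
split.
- have := le_of_sqrD_le_linear _ _ _ _ _ k8 Lnt Mt h'.
  rewrite mulrC -ler_pdivlMr// => /le_trans; apply.
  by rewrite le_eqVlt; apply/orP; left; apply/eqP; field; rewrite nuz tauz kz.
- have h2 := h'; rewrite addrC [X in 8 / k * X]addrC in h2.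
  have := le_of_sqrD_le_linear _ _ _ _ _ k8 Mt Lnt h2.
  rewrite mulrC -ler_pdivlMr// => /le_trans; apply.
  by rewrite le_eqVlt; apply/orP; left; apply/eqP; field; rewrite nuz tauz kz.
Qed.

(** * The panel model *)

Section Panel.
Context {R : realType} {N T p : nat}.
Hypotheses (N_gt0 : (0 < N)%N) (T_gt0 : (0 < T)%N).
Implicit Types (x : 'I_N -> 'I_T -> 'I_p -> R).

Let sqrtNT_gt0 : 0 < Num.sqrt (N * T)%:R :> R.
Proof. by rewrite sqrtr_gt0 ltr0n muln_gt0 N_gt0. Qed.

Let sqrtT_gt0 : 0 < Num.sqrt T%:R :> R.
Proof. by rewrite sqrtr_gt0 ltr0n. Qed.

Lemma stack_model x (y e : 'I_N -> 'I_T -> R) (b : 'cV[R]_p) (c : 'cV[R]_N) :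
  (forall i t, y i t = \sum_(j < p) x i t j * b j 0 + c i 0 + e i t) ->
  stack y = regressors x *m col_mx b c + stack e.
Proof.
move=> model.
rewrite /regressors mul_row_col /design /dummies /stack !mxcol_mul -!mxcolD.
apply: eq_mxcol => i; apply/matrixP => t j; rewrite !mxE model.
congr (_ + _ + _).
  by apply: eq_bigr => k _; rewrite mxE ord1.
rewrite (bigD1 i)//= !mxE eqxx mul1r big1 ?addr0 ?ord1// => k ki.
by rewrite mxE (negbTE ki) mul0r.
Qed.

Lemma scaling_unit : scaling R N T p \in unitmx.
Proof.
rewrite unitmxE /scaling det_ublock !det_scalar unitfE.
by rewrite mulf_neq0// expf_neq0// gt_eqF.
Qed.

Lemma scaling_mul (u : 'cV[R]_p) (v : 'cV[R]_N) :
  scaling R N T p *m col_mx u v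
    = col_mx (Num.sqrt (N * T)%:R *: u) (Num.sqrt T%:R *: v).
Proof.
by rewrite /scaling mul_block_col !mul0mx addr0 add0r !mul_scalar_mx.
Qed.

(** The scaling built into [Psi] cancels the rescaling of the error vector. *)
Lemma Psi_scaling x (z : 'cV[R]_(p + N)) :
  let delta := scaling R N T p *m z in
  (delta^T *m Psi x *m delta) 0 0 = l2norm (regressors x *m z) ^+ 2.
Proof.
rewrite /= sqr_l2normE.
have trS : (scaling R N T p)^T = scaling R N T p.
  by rewrite /scaling tr_block_mx !tr_scalar_mx !trmx0.
rewrite !trmx_mul trS /Psi !mulmxA.
by rewrite (mulmxK scaling_unit) (mulmxKV scaling_unit).
Qed.

(** Rescaling by the square roots of the panel dimensions turns the weights
[lambda / Num.sqrt (N * T)] and [mu / Num.sqrt T] of the cone back into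
[lambda] and [mu]. *)
Lemma re_cone_scaling (lambda mu : R) (A : {set 'I_p}) (B : {set 'I_N})
    (u : 'cV[R]_p) (v : 'cV[R]_N) :
  lambda * l1norm u + mu * l1norm v
    <= 4 * lambda * l1norm_on A u + 4 * mu * l1norm_on B v ->
  re_cone T lambda mu A B (scaling R N T p *m col_mx u v).
Proof.
rewrite (l1norm_split A) (l1norm_split B) => h.
rewrite /re_cone scaling_mul col_mxKu col_mxKd.
rewrite !(l1norm_onZ _ _ _ (ltW sqrtNT_gt0)) !(l1norm_onZ _ _ _ (ltW sqrtT_gt0)).
rewrite -[3 * _ * _]mulrA -[3 * (mu / _) * _]mulrA.
rewrite !mulrA !divfK ?gt_eqF//; lra.
Qed.

Lemma kappa2_le (lambda mu : R) (M : 'M[R]_(p + N)) (A : {set 'I_p})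
    (B : {set 'I_N}) (delta : 'cV[R]_(p + N)) :
  delta != 0 -> re_cone T lambda mu A B delta ->
  (kappa2 T lambda mu M #|A| #|B|
    <= ((delta^T *m M *m delta) 0 0 / l2norm delta ^+ 2)%:E)%E.
Proof.
move=> delta0 cone; apply: ereal_inf_lbound; exists delta => //.
by split=> //; exists A, B.
Qed.

End Panel.

Lemma divemul_fin {R : realType} (a k m : R) :
  0 < k -> 0 < m -> (a%:E / (k%:E * m%:E) = (a / (k * m))%:E)%E.
Proof. by move=> k0 m0; rewrite -EFinM inver gt_eqF ?mulr_gt0. Qed.

Theorem theorem1 (R : realType) (d : measure_display) (Omega : measurableType d)
  (P : probability Omega R) (N T p : nat) (N_gt0 : (0 < N)%N) (T_gt0 : (0 < T)%N)
  (x : 'I_N -> 'I_T -> 'I_p -> {RV P >-> R})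
  (y eps : 'I_N -> 'I_T -> {RV P >-> R})
  (betastar : 'cV[R]_p) (cstar : 'cV[R]_N)
  (model : forall i t w,
     y i t w = \sum_(j < p) x i t j w * betastar j 0 + cstar i 0 + eps i t w)
  (gramE : gram_integrable x)
  (lambda mu : R) (lambda_gt0 : 0 < lambda) (mu_gt0 : 0 < mu)
  (betahat : Omega -> 'cV[R]_p) (chat : Omega -> 'cV[R]_N)
  (lasso : forall w, panel_lasso lambda mu (covariates_at x w) (panel_at y w)
                       (betahat w) (chat w))
  (s1 s2 : nat) (s1E : s1 = #|supp betastar|) (s2E : s2 = #|supp cstar|)
  (kappasq : \bar R)
  (kappasqE : kappasq = kappa2 T lambda mu (Gamma x) s1 s2)
  (kappasq_gt0 : (0 < kappasq)%E) (w : Omega) :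
  (eventA x eps lambda mu `&` eventB x lambda mu s1 s2) w ->
  ((l2norm (betahat w - betastar))%:E
     <= (8 * lambda * Num.sqrt s1%:R)%:E / (kappasq * (N%:R * T%:R)%:E)
        + (4 * mu * Num.sqrt s2%:R)%:E / (kappasq * (Num.sqrt N%:R * T%:R)%:E))%E
  /\
  ((l2norm (chat w - cstar))%:E
     <= (8 * mu * Num.sqrt s2%:R)%:E / (kappasq * T%:R%:E)
        + (4 * lambda * Num.sqrt s1%:R)%:E / (kappasq * (Num.sqrt N%:R * T%:R)%:E))%E.
Proof.
move=> [[hX hD] hB].
set u := betahat w - betastar; set v := chat w - cstar.
have basic : l2norm (regressors (covariates_at x w) *m col_mx u v) ^+ 2
      + lambda * l1norm u + mu * l1norm v
    <= 4 * lambda * l1norm_on (supp betastar) u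
      + 4 * mu * l1norm_on (supp cstar) v.
  apply: (lasso_basic_inequality _ _ _ _ _ _ _ _ _ lambda_gt0 mu_gt0 hX hD).
  have := lasso w betastar cstar.
  by rewrite /lasso_objective (stack_model _ _ _ _ _ (fun i t => model i t w)).
set delta := scaling R N T p *m col_mx u v.
have kappa_ge0 : (0 <= kappasq)%E by exact: ltW.
have rhs_ge0 (a m : R) : 0 <= a -> 0 <= m -> (0 <= a%:E / (kappasq * m%:E))%E.
  by move=> a0 m0; rewrite mule_ge0 ?lee_fin// inve_ge0 mule_ge0 ?lee_fin.
have [delta0|delta_neq0] := eqVneq delta 0.
  have /eqP : col_mx u v = 0.
    by rewrite -[col_mx u v](mulKmx (scaling_unit N_gt0 T_gt0)) -/delta delta0
       mulmx0.
  rewrite col_mx_eq0 => /andP[/eqP -> /eqP ->]; rewrite !l2norm0.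
  by split; apply: adde_ge0; apply: rhs_ge0;
     rewrite ?mulr_ge0 ?sqrtr_ge0 ?ler0n ?ltW.
have cone : re_cone T lambda mu (supp betastar) (supp cstar) delta.
  apply: re_cone_scaling => //; apply: le_trans basic.
  by rewrite -addrA lerDr sqr_ge0.
(* The admissible vector [delta] bounds [kappasq] above by a real number. *)
have [k kE] : exists k, kappasq = k%:E.
  have := kappa2_le _ _ (Gamma x) _ _ _ delta_neq0 cone.
  rewrite -s1E -s2E -kappasqE.
  by case: (kappasq) kappasq_gt0 => [k| |] // _ _; exists k.
have k_gt0 : 0 < k by rewrite -lte_fin -kE.
have curvature : k / 2 * l2norm delta ^+ 2
    <= l2norm (regressors (covariates_at x w) *m col_mx u v) ^+ 2.
  rewrite -Psi_scaling// -/delta -ler_pdivlMr ?exprn_gt0 ?l2norm_gt0//.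
  have := kappa2_le _ _ (Psi (covariates_at x w)) _ _ _ delta_neq0 cone.
  rewrite -s1E -s2E => /(le_trans hB).
  by rewrite -kappasqE kE inver pnatr_eq0/= -EFinM lee_fin.
have U0 := l1norm_on_le (supp betastar) u; rewrite -s1E in U0.
have V0 := l1norm_on_le (supp cstar) v; rewrite -s2E in V0.
have linear : k / 2 * ((Num.sqrt N%:R * Num.sqrt T%:R * l2norm u) ^+ 2
                       + (Num.sqrt T%:R * l2norm v) ^+ 2)
    <= 4 * (lambda * Num.sqrt s1%:R * l2norm u + mu * Num.sqrt s2%:R * l2norm v).
  move: curvature; rewrite /delta scaling_mul sqr_l2norm_col_mx.
  rewrite !l2normZ ?sqrtr_ge0// natrM sqrtrM ?ler0n// => curvature.
  have := ler_wpM2l (ltW lambda_gt0) U0; have := ler_wpM2l (ltW mu_gt0) V0.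
  have := mulr_ge0 (ltW lambda_gt0) (l1norm_ge0 u).
  have := mulr_ge0 (ltW mu_gt0) (l1norm_ge0 v).
  rewrite !mulrA; lra.
have sqrtN0 : 0 < Num.sqrt N%:R :> R by rewrite sqrtr_gt0 ltr0n.
have sqrtT0 : 0 < Num.sqrt T%:R :> R by rewrite sqrtr_gt0 ltr0n.
have L0 : 0 <= lambda * Num.sqrt s1%:R by rewrite mulr_ge0 ?sqrtr_ge0// ltW.
have M0 : 0 <= mu * Num.sqrt s2%:R by rewrite mulr_ge0 ?sqrtr_ge0// ltW.
have := rescaled_error_bounds _ _ _ _ _ _ _ sqrtN0 sqrtT0 k_gt0 L0 M0 linear.
rewrite !sqr_sqrtr ?ler0n// !mulrA => -[hu hv].
rewrite kE !divemul_fin ?mulr_gt0 ?ltr0n// -!EFinD !lee_fin !mulrA.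
by split.
Qed.
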